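(* Let $\cdot$ be a unitary, nonsingular and strong right partial action of a semigroup $S$ on a set $A$. Then the triple $(A^S,\lambda,* )$ is a terminal object in the category $\mathcal{G}_A(A,S,\cdot)$ of $A$-generated globalizations of $(A,\cdot)$.
   Context: A partial map $f\colon X\to Y$ is a map $Z\to Y$ with $Z\subseteq X$, $Z=\mathrm{dom}(f)$; $f(x)$ is defined iff $x\in Z$; two partial maps are equal iff they have the same domain and the same values. All actions are right actions. A global action of $S$ on a set $B$ is a map $*\colon B\times S\to B$ with $(b*s)*t=b*(st)$; then $(B,* )$ is a global $S$-act. A partial action of $S$ on $A$ is a partial map $\cdot\colon A\times S\to A$ such that if $a\cdot s$ and $(a\cdot s)\cdot t$ are defined, then $a\cdot st$ is defined and $(a\cdot s)\cdot t=a\cdot st$. It is strong if whenever $a\cdot s$ and $a\cdot st$ are defined, $(a\cdot s)\cdot t$ is defined and $(a\cdot s)\cdot t=a\cdot st$. It is unitary if for each $a\in A$ there are $b\in A$, $s\in S$ such that $b\cdot s$ is defined and $a=b\cdot s$. For $a\in A$, $s\in S$ let $f_{a,s}\colon S\to A$ be the partial map with $\mathrm{dom}(f_{a,s})=\{t\in S: a\cdot st\text{ is defined}\}$ and $f_{a,s}(t)=a\cdot st$. Put $A^S=\{f_{a,s}: a\in A,s\in S\}$. If $\cdot$ is strong, $f_{a,s}*t=f_{a,st}$ is a well-defined global action of $S$ on $A^S$. The partial action is nonsingular if whenever $f_{a,s}=f_{b,t}$ and $a\cdot s$ is defined, then $b\cdot t$ is defined and $a\cdot s=b\cdot t$. For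 unitary and strong $\cdot$, $\lambda\colon A\to A^S$ is the well-defined map $\lambda(a)=f_{b,s}$ whenever $a=b\cdot s$. A globalization of $(A,\cdot)$ is a global $S$-act $(B,* )$ together with an injective map $\iota\colon A\to B$ such that for all $a\in A,s\in S$: (G1) $a\cdot s$ is defined iff $\iota(a)*s\in\iota(A)$; (G2) if $a\cdot s$ is defined then $\iota(a\cdot s)=\iota(a)*s$. It is $A$-generated if every $b\in B$ equals $\iota(a)*s$ for some $a\in A$, $s\in S$. The category $\mathcal{G}_A(A,S,\cdot)$ has as objects the triples $(B,\iota,* )$ where $(B,* )$ is an $A$-generated globalization of $(A,\cdot)$ via $\iota$; a morphism $(B,\iota,* )\to(C,i,\circ)$ is a map $\varphi\colon B\to C$ with $\varphi(b*s)=\varphi(b)\circ s$ for all $b\in B,s\in S$, and $\varphi\iota=i$. *)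

(* Defs.v *)
From mathcomp Require Import all_boot boolp.

Set Implicit Arguments.
Unset Strict Implicit.
Unset Printing Implicit Defensive.

Local Open Scope group_scope.

(* Classical logic and choice (boolp) are used throughout.  In particular      *)
(* - a partial map X -> Y is a function X -> option Y, None meaning            *)
(*   "undefined"; Leibniz equality of such functions is equality of domains    *)
(*   and of values (funext);                                                   *)
(* - the choiceType component of semigroupType is no restriction, since every  *)
(*   type has such a structure classically.                                    *)

Record partial_action (S : semigroupType) (A : Type) := PartialAction {
  pact :> A -> S -> option A;
  pactM : forall a s t b c,
    pact a s = Some b -> pact b t = Some c -> pact a (s * t) = Some c
}.

Record global_act (S : semigroupType) := GlobalAct {
  act_sort :> Type;
  act : act_sort -> S -> act_sort;
  actM : forall b s t, act (act b s) t = act b (s * t)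
}.

Section PartialActions.
Variables (S : semigroupType) (A : Type) (p : partial_action S A).

Definition strong :=
  forall a s t b c, p a s = Some b -> p a (s * t) = Some c -> p b t = Some c.

Definition unitary := forall a, exists b s, p b s = Some a.

(* f_{a,s} *)
Definition translate (a : A) (s : S) : S -> option A := fun t => p a (s * t).

Definition nonsingular :=
  forall a b s t, translate a s = translate b t ->
  forall c, p a s = Some c -> p b t = Some c.

(* A^S *)
Definition translates : Type :=
  {f : S -> option A | exists a s, f = translate a s}.

Definition mk_translate (a : A) (s : S) : translates :=
  exist _ (translate a s) (ex_intro _ a (ex_intro _ s erefl)).

Lemma translates_surj (f : translates) :
  exists x : A * S, f = mk_translate x.1 x.2.
Proof.
by case: f => f [a [s fE]]; exists (a, s); rewrite /=; apply: eq_exist.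
Qed.

(* f_{a,s} * t = f_{a,st} for a chosen representative (a, s); star_mk shows    *)
(* that the choice is irrelevant.                                              *)
Definition star (f : translates) (t : S) : translates :=
  let x := sval (cid (translates_surj f)) in mk_translate x.1 (x.2 * t).

Lemma star_mk a s t : star (mk_translate a s) t = mk_translate a (s * t).
Proof.
rewrite /star; case: cid => -[b u] /= /(congr1 sval) /= E.
apply: eq_exist; apply/funext => v.
by have := congr1 (@^~ (t * v)) E; rewrite /translate /= !mulgA.
Qed.

Lemma starM f s t : star (star f s) t = star f (s * t).
Proof. by have [[a u] ->] := translates_surj f; rewrite !star_mk mulgA. Qed.

Definition translates_act : global_act S := GlobalAct starM.

Lemma unitary_pair (hu : unitary) (a : A) :
  exists x : A * S, p x.1 x.2 = Some a.
Proof. by have [b [s E]] := hu a; exists (b, s). Qed.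

(* f_{b,s} for a chosen pair with a = b.s; the choice is irrelevant when p is  *)
(* strong (lambdaE).                                                           *)
Definition lambda (hu : unitary) (a : A) : translates_act :=
  let x := sval (cid (unitary_pair hu a)) in mk_translate x.1 x.2.

Lemma strong_translate : strong ->
  forall a b s, p b s = Some a -> translate b s = p a.
Proof.
move=> hs a b s E; apply/funext => t; rewrite /translate.
case E1: (p b (s * t)) => [c|]; first by rewrite (hs _ _ _ _ _ E E1).
by case E2: (p a t) => [c|] //; rewrite (pactM E E2) in E1.
Qed.

Lemma lambdaE (hu : unitary) : strong ->
  forall a b s, p b s = Some a -> lambda hu a = mk_translate b s.
Proof.
move=> hs a b s E; rewrite /lambda; case: cid => -[c t] /= E'.
by apply: eq_exist; rewrite !(@strong_translate hs a).
Qed.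

Definition is_globalization (B : global_act S) (iota : A -> B) :=
  [/\ injective iota,
      forall a s, isSome (p a s) <-> exists b, iota b = act (iota a) s
    & forall a s b, p a s = Some b -> iota b = act (iota a) s].

Definition is_generated (B : global_act S) (iota : A -> B) :=
  forall b : B, exists a s, b = act (iota a) s.

Record gen_globalization := GenGlobalization {
  gg_act :> global_act S;
  gg_map : A -> gg_act;
  gg_globalization : is_globalization gg_map;
  gg_generated : is_generated gg_map
}.

Definition is_gg_morphism (X Y : gen_globalization) (phi : X -> Y) :=
  (forall b s, phi (act b s) = act (phi b) s) /\
  (forall a, phi (gg_map X a) = gg_map Y a).

Definition gg_hom (X Y : gen_globalization) : Type :=
  {phi : X -> Y | is_gg_morphism phi}.

Definition gg_id (X : gen_globalization) : gg_hom X X :=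
  exist (@is_gg_morphism X X) id (conj (fun _ _ => erefl) (fun _ => erefl)).

Lemma gg_comp_subproof (X Y Z : gen_globalization)
    (g : gg_hom Y Z) (f : gg_hom X Y) :
  @is_gg_morphism X Z (sval g \o sval f).
Proof.
case: f g => [f [f1 f2]] [g [g1 g2]]; split=> /= [b s|a].
  by rewrite f1 g1.
by rewrite f2 g2.
Qed.

Definition gg_comp (X Y Z : gen_globalization)
    (g : gg_hom Y Z) (f : gg_hom X Y) : gg_hom X Z :=
  exist _ _ (gg_comp_subproof g f).

End PartialActions.

Record category := Category {
  obj :> Type;
  hom : obj -> obj -> Type;
  idm : forall X, hom X X;
  comp : forall X Y Z, hom Y Z -> hom X Y -> hom X Z;
  comp1m : forall X Y (f : hom X Y), comp (idm Y) f = f;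
  compm1 : forall X Y (f : hom X Y), comp f (idm X) = f;
  compA : forall X Y Z W (h : hom Z W) (g : hom Y Z) (f : hom X Y),
    comp h (comp g f) = comp (comp h g) f
}.

Definition terminal (C : category) (T : C) :=
  forall X : C, exists f : hom X T, forall g : hom X T, g = f.

(* G_A(A,S,.) *)
Definition GA (S : semigroupType) (A : Type) (p : partial_action S A) :
  category.
Proof.
refine (@Category (gen_globalization p) (@gg_hom S A p) (@gg_id S A p)
  (@gg_comp S A p) _ _ _).
- by move=> X Y [f ?]; apply: eq_exist.
- by move=> X Y [f ?]; apply: eq_exist.
- by move=> X Y Z W h g f; apply: eq_exist.
Defined.

(* Main.v *)
(* Every b in an A-generated globalization (B, iota) determines the partial    *)
(* map t |-> iota^-1(b * t); for b = iota(a) * s this is f_{a,s}, by (G1) and  *)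
(* (G2).  Hence iota(a) * s |-> f_{a,s} is well defined; a morphism to A^S     *)
(* must take these values because lambda(a) * s = f_{a,s}.                     *)
Require Import Defs.
From mathcomp Require Import all_boot.
From mathcomp Require Import boolp.

Set Implicit Arguments.
Unset Strict Implicit.
Unset Printing Implicit Defensive.

Local Open Scope group_scope.

Section Terminal.
Variables (S : semigroupType) (A : Type) (p : partial_action S A).

(** That $A^S$ is itself an object of the category rests on [act_lambda] and [lambda_eq_translate]:
    together they turn $\lambda(c) = \lambda(a) * s$ into $a\cdot s = c$, which yields (G1) and
    (G2). Terminality then follows from [translate_globalization] (existence) and from generation by
    $\iota(A)$ (uniqueness). *)

Lemma globalizationP (B : global_act S) (iota : A -> B) :
  is_globalization p iota ->
  forall a s c, p a s = Some c <-> iota c = act (iota a) s.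
Proof.
move=> [inj G1 G2] a s c; split=> [/G2 //|E].
have := proj2 (G1 a s) (ex_intro _ c E).
by case pas: (p a s) => [d|] // _; congr Some; apply: inj; rewrite E (G2 _ _ _ pas).
Qed.

(** By [globalizationP], $a\cdot su = c$ amounts to $\iota(c) = (\iota(a)*s)*u$, which sees only
    $\iota(a)*s$. *)
Lemma translate_globalization (B : global_act S) (iota : A -> B) :
  is_globalization p iota ->
  forall a b s t, act (iota a) s = act (iota b) t ->
  translate p a s = translate p b t.
Proof.
move=> glob a b s t E; apply/funext => u; rewrite /translate.
have eqv c : p a (s * u) = Some c <-> p b (t * u) = Some c.
  by rewrite !(globalizationP glob) -!actM E.
case E1: (p a (s * u)) => [c|]; first by have /eqv := E1.
by case E2: (p b (t * u)) => [c|] //; move/eqv: E2; rewrite E1.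
Qed.

Hypotheses (hu : unitary p) (hn : nonsingular p) (hs : strong p).

(** If $a = b\cdot t$, strength makes $f_{b,t}$ the map $u \mapsto a\cdot u$; shifting by $s$ gives
    $f_{b,ts} = f_{a,s}$. *)
Lemma act_lambda a s : act (lambda hu a) s = mk_translate p a s.
Proof.
have [b [t bt]] := hu a; rewrite (lambdaE hu hs bt) [LHS]star_mk.
apply: eq_exist; apply/funext => u.
by rewrite /translate -(strong_translate hs bt) /translate !mulgA.
Qed.

(** Nonsingularity enters here: it recovers the value $b\cdot s$ from $f_{b,s}$ alone. *)
Lemma lambda_eq_translate a b s :
  lambda hu a = mk_translate p b s <-> p b s = Some a.
Proof.
split=> [|E]; last exact: lambdaE.
have [c [t ct]] := hu a.
by rewrite (lambdaE hu hs ct) => /(congr1 sval) /= /hn; apply.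
Qed.

Lemma lambda_globalization : is_globalization p (lambda hu).
Proof.
split=> [a b E|a s|a s b /lambda_eq_translate ->]; last by rewrite act_lambda.
(* Injectivity: with $b = c\cdot s$, the equality $\lambda(a) = f_{c,s}$ forces $c\cdot s = a$ as
   well. *)
- have [c [s cs]] := hu b; move: E; rewrite (lambdaE hu hs cs).
  by move/lambda_eq_translate; rewrite cs => -[].
- rewrite act_lambda; split=> [|[b /lambda_eq_translate -> //]].
  by case E: (p a s) => [b|] // _; exists b; apply/lambda_eq_translate.
Qed.

Lemma lambda_generated : is_generated (lambda hu).
Proof.
move=> f; have [[a s] ->] := translates_surj f.
by exists a, s; rewrite act_lambda.
Qed.

Lemma terminal_lambda :
  terminal (C := GA p) (GenGlobalization lambda_globalization lambda_generated).
Proof.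
move=> X; have glob := gg_globalization X.
have gen (x : X) : exists y : A * S, x = act (gg_map X y.1) y.2.
  by have [a [s E]] := gg_generated x; exists (a, s).
pose phi (x : X) : translates_act p :=
  let y := sval (cid (gen x)) in mk_translate p y.1 y.2.
have phiE a s : phi (act (gg_map X a) s) = mk_translate p a s.
  rewrite /phi; case: cid => -[b t] /= E.
  by apply: eq_exist; apply: translate_globalization glob _ _ _ _ _.
have phi_mor : @is_gg_morphism _ _ p X
    (GenGlobalization lambda_globalization lambda_generated) phi.
  split=> [x s|a] /=.
    have [[a t] ->] := gen x.
    by rewrite actM !phiE [RHS]star_mk.
  (* Writing $a = b\cdot s$ puts $\iota(a)$ in the form $\iota(b)*s$, on which [phiE] computes
     [phi]. *)
  have [b [s bs]] := hu a.
  by rewrite (proj1 (globalizationP glob _ _ _) bs) phiE (lambdaE hu hs bs).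
exists (exist _ phi phi_mor) => -[g [g_act g_map]]; apply: eq_exist.
apply/funext => x; have [[a s] ->] := gen x.
by rewrite phiE g_act g_map; exact: act_lambda.
Qed.

End Terminal.

Theorem corollary4p9 (S : semigroupType) (A : Type) (p : partial_action S A)
    (hu : unitary p) (hn : nonsingular p) (hs : strong p) :
  exists (hglob : is_globalization p (lambda hu))
         (hgen : is_generated (lambda hu)),
    terminal (C := GA p) (GenGlobalization hglob hgen).
Proof. by do 2!eexists; exact: terminal_lambda. Qed.
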